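(* Let $\ell$ be an odd prime. Suppose that $A,C\in\mathcal{G}$, that $\operatorname{rank} A=\operatorname{rank} C=r$, and that there does not exist an injective group homomorphism $\iota:A\hookrightarrow C$ such that $\operatorname{coker}(\iota)$ is elementary abelian. Then $S(A,C)=0$.
   Context: Fix an odd prime $\ell$. $\mathcal{G}$ is the poset of isomorphism classes of finite abelian $\ell$-groups (a group and its isomorphism class are identified, so $=$ in $\mathcal{G}$ means isomorphic), ordered by $A\leq B$ if and only if there is an injective group homomorphism $A\hookrightarrow B$; $A<B$ means $A\leq B$ and $A\not\cong B$. For $A\in\mathcal{G}$, $\operatorname{rank} A:=\dim_{\mathbb{F}_\ell}(A/\ell A)$. An elementary abelian group here is a group isomorphic to $(\mathbb{Z}/\ell)^n$ for some $n\geq 0$ (the trivial group included). For $A,C\in\mathcal{G}$, $\operatorname{sub}(A,C)$ is the number of subgroups of $C$ that are isomorphic to $A$. An $A$-chain is a finite linearly ordered subset of $\{B\in\mathcal{G}\mid B>A\}$. For an $A$-chain $\mathfrak{C}=\{A_j\}_{j=1}^i$ with $i\ge 1$ and $A<A_1<\cdots<A_i$, set $$\operatorname{sub}(\mathfrak{C}):=(-1)^i\operatorname{sub}(A,A_1)\prod_{j=1}^{i-1}\operatorname{sub}(A_j,A_{j+1}).$$ The function $S:\mathcal{G}\times\mathcal{G}\to\mathbb{Z}$ is defined by $S(A,C)=0$ if $A\nleq C$; $S(A,C)=1$ if $A=C$; and $S(A,C)=\sum_{\mathfrak{C}}\operatorname{sub}(\mathfrak{C})$ if $A<C$, where the sum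 is over all $A$-chains $\mathfrak{C}$ with $\max\mathfrak{C}=C$. *)

(* Defs.v *)
From HB Require Import structures.
From mathcomp Require Import all_boot all_order all_algebra all_fingroup all_solvable.

Set Implicit Arguments.
Unset Strict Implicit.
Unset Printing Implicit Defensive.

Import Order.TTheory GRing.Theory Num.Theory GroupScope.

(* Elements of the poset of isomorphism classes of finite abelian ell-groups are
   handled through representatives {group gT}, equality in the poset being
   \isog. *)

Definition injects (aT bT : finGroupType) (A : {set aT}) (B : {set bT}) : bool :=
  [exists f : {ffun aT -> bT},
    [&& morphic A f, dinjectiveb f A & f @: A \subset B]].

Lemma injectsP (aT bT : finGroupType) (A : {group aT}) (B : {group bT}) :
  reflect (exists2 f : {morphism A >-> bT}, 'injm f & f @* A \subset B)
          (injects A B).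
Proof.
apply: (iffP existsP) => [[f /and3P[fM /dinjectiveP f_inj sfAB]]|[f f_inj sfAB]].
  exists (morphm_morphism fM); first exact/injmP.
  by rewrite /morphim setIid.
have ffE : [ffun x => f x] =1 f by move=> x; rewrite ffunE.
exists [ffun x => f x]; apply/and3P; split.
- by apply/morphicP=> x y Ax Ay; rewrite !ffunE morphM.
- by apply/dinjectiveP=> x y Ax Ay; rewrite !ffunE; apply: (injmP f_inj).
- by move: sfAB; rewrite /morphim setIid (eq_imset _ ffE).
Qed.

Definition lt_iso (aT bT : finGroupType) (A : {set aT}) (B : {set bT}) : bool :=
  injects A B && ~~ (A \isog B).

(* dim_{F_ell} (A / ell A), for abelian A: an F_ell-space of dimension n has ell ^ n
   elements, and the set of ell-th powers of A is a subgroup, so that the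
   generated group below is that very set. *)
Definition rank_mod (ell : nat) (gT : finGroupType) (A : {set gT}) : nat :=
  logn ell #|A / <<[set x ^+ ell | x in A]>>|.

Definition nsub (aT cT : finGroupType) (A : {set aT}) (C : {set cT}) : nat :=
  #|[set H : {group cT} | (H \subset C) && (A \isog H)]|.

(* Every member of a chain with maximum C is <= C, hence is the isomorphism
   class of a subgroup of C. We fix one subgroup of C in each such class; then
   chains with maximum C are exactly certain subsets of [iso_reps C]. *)
Definition iso_reps (cT : finGroupType) (C : {set cT}) : {set {group cT}} :=
  transversal
    (equivalence_partition (fun H K : {group cT} => H \isog K) (subgroups C))
    (subgroups C).

Lemma iso_repsP (cT : finGroupType) (C : {group cT}) :
  [/\ {in iso_reps C, forall H : {group cT}, H \subset C},
      {in iso_reps C &, forall H K : {group cT}, H \isog K -> H = K}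
    & forall H : {group cT}, H \subset C ->
        exists2 K : {group cT}, K \in iso_reps C & H \isog K].
Proof.
pose e (H K : {group cT}) := H \isog K.
have eqv : {in subgroups C & &, equivalence_rel e}.
  move=> H K L _ _ _; split=> [|isoHK]; first exact: isog_refl.
  by rewrite /e; apply: isog_transl.
have parP := equivalence_partitionP eqv.
have trX := transversalP parP.
have [/eqP covP triP _] := and3P parP.
have sXD := transversal_sub trX.
split=> [H /(subsetP sXD)|H K XH XK isoHK|H sHC]; first by rewrite inE.
- apply: (pblock_inj trX) => //; apply/eqP.
  have [DH DK] := (subsetP sXD _ XH, subsetP sXD _ XK).
  rewrite eq_pblock ?covP //.
  by rewrite (pblock_equivalence_partition eqv).
have DH : H \in subgroups C by rewrite inE.
have PH : pblock (equivalence_partition e (subgroups C)) H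
            \in equivalence_partition e (subgroups C).
  by rewrite pblock_mem ?covP.
have XK := repr_mem_transversal trX H PH.
have BK := repr_mem_pblock trX H PH.
exists (transversal_repr H (iso_reps C)
         (pblock (equivalence_partition e (subgroups C)) H)) => //.
by move: BK; rewrite (pblock_equivalence_partition eqv) ?(subsetP sXD _ XK).
Qed.

(* [X] stands for a finite linearly ordered set of isomorphism classes > A. *)
Definition is_chain (aT cT : finGroupType) (A : {set aT})
    (X : {set {group cT}}) : bool :=
  [forall B : {group cT} in X, lt_iso A B] &&
  [forall B : {group cT} in X, forall D : {group cT} in X,
     injects B D || injects D B].

Definition chains_to (aT cT : finGroupType) (A : {set aT}) (C : {group cT}) :
    {set {set {group cT}}} :=
  [set X : {set {group cT}} | [&& X \subset iso_reps C, is_chain A X, C \in X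
     & [forall B : {group cT} in X, injects B C]]].

(* The members A_1 < ... < A_i of a chain X are listed in increasing order as
   s_0, ..., s_(i-1). The value at X = set0 is irrelevant. *)
Definition sub_chain (aT cT : finGroupType) (A : {set aT})
    (X : {set {group cT}}) : int :=
  let s := sort (fun B D : {group cT} => injects B D) (enum X) in
  let s_ j := nth 1%G s j in
  ((-1) ^+ #|X| * (nsub A (s_ 0))%:R *
     \prod_(0 <= j < #|X|.-1) (nsub (s_ j) (s_ j.+1))%:R)%R.

Definition Sfun (aT cT : finGroupType) (A : {set aT}) (C : {group cT}) : int :=
  if ~~ injects A C then 0%R
  else if A \isog C then 1%R
  else (\sum_(X in chains_to A C) sub_chain A X)%R.

(* Main.v *)
(* Splitting a chain at its second largest member shows that S(A, -) is the
   function whose sum over the subgroups H of any M <= C is [A ~ M]. Grouping the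
   subgroups H of M by H * Phi(C) inverts this relation on the interval
   [Phi(C), C] alone. The M in that interval are exactly the subgroups with
   elementary abelian quotient C / M; when none is isomorphic to A, all the
   grouped sums vanish, and the one over H * Phi(C) = C is S(A, C) itself because
   Phi(C) consists of non-generators. *)

Require Import Defs.
From mathcomp Require Import all_boot all_order all_algebra all_fingroup all_solvable.
Import GroupScope.

Set Implicit Arguments.
Unset Strict Implicit.
Unset Printing Implicit Defensive.

(** * Embeddings and subgroup counts up to isomorphism *)

Lemma injects_isogP (aT bT : finGroupType) (A : {group aT}) (B : {group bT}) :
  reflect (exists2 K : {group bT}, K \subset B & A \isog K) (injects A B).
Proof.
apply: (iffP (injectsP A B)) => [[f f_inj sfAB]|[K sKB /isogP[f f_inj fA]]].
  by exists (f @* A)%G => //; exact: sub_isog.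
by exists f; rewrite ?fA.
Qed.

Lemma isog_injects (aT bT : finGroupType) (A : {group aT}) (B : {group bT}) :
  A \isog B -> injects A B.
Proof. by move=> isoAB; apply/injects_isogP; exists B. Qed.

Lemma injects_trans (aT bT cT : finGroupType)
    (A : {group aT}) (B : {group bT}) (C : {group cT}) :
  injects A B -> injects B C -> injects A C.
Proof.
move=> /injects_isogP[K sKB isoAK] /injectsP[f f_inj sfBC].
apply/injects_isogP; exists (f @* K)%G.
  exact: subset_trans (morphimS f sKB) sfBC.
by rewrite (isog_transl _ isoAK); exact: sub_isog.
Qed.

Lemma leq_card_injects (aT bT : finGroupType) (A : {group aT}) (B : {group bT}) :
  injects A B -> #|A| <= #|B|.
Proof.
by case/injects_isogP=> K sKB /card_isog->; exact: subset_leq_card.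
Qed.

(** The image of [A] in [B] has order at least that of [B], so it is all of [B]. Antisymmetry of the
    order on isomorphism classes follows. *)
Lemma injects_isog (aT bT : finGroupType) (A : {group aT}) (B : {group bT}) :
  injects A B -> #|B| <= #|A| -> A \isog B.
Proof.
case/injects_isogP=> K sKB isoAK; rewrite (card_isog isoAK) => leBK.
suff <- : K :=: B by [].
by apply/eqP; rewrite eqEcard sKB.
Qed.

Lemma injects_anti_isog (aT bT : finGroupType) (A : {group aT}) (B : {group bT}) :
  injects A B -> injects B A -> A \isog B.
Proof. by move=> AB /leq_card_injects; exact: injects_isog. Qed.

Lemma nsub_gt0 (aT cT : finGroupType) (A : {group aT}) (C : {group cT}) :
  (0 < nsub A C) = injects A C.
Proof.
apply/card_gt0P/injects_isogP => [[K]|[K sKC isoAK]].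
  by rewrite inE => /andP[]; exists K.
by exists K; rewrite inE sKC.
Qed.

Lemma nsub_isogl (aT bT cT : finGroupType)
    (A : {group aT}) (B : {group bT}) (C : {group cT}) :
  A \isog B -> nsub A C = nsub B C.
Proof.
by move=> isoAB; apply: eq_card => H; rewrite !inE (isog_transl _ isoAB).
Qed.

(** An isomorphism carries subgroups to subgroups injectively and preserves their class. This gives
    one inequality, and the inverse isomorphism gives the other. *)
Lemma nsub_isogr (aT cT dT : finGroupType)
    (A : {group aT}) (C : {group cT}) (D : {group dT}) :
  C \isog D -> nsub A C = nsub A D.
Proof.
suff le (eT fT : finGroupType) (E : {group eT}) (F : {group fT}) :
    E \isog F -> nsub A E <= nsub A F.
  by move=> isoCD; apply/eqP; rewrite eqn_leq !le // isog_sym.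
case/isogP=> f f_inj fE.
rewrite {1}/nsub -(card_in_imset (f := fun H : {group eT} => (f @* H)%G)).
  apply/subset_leq_card/subsetP=> _ /imsetP[H + ->].
  rewrite !inE => /andP[sHE isoAH]; rewrite -fE morphimS //=.
  by rewrite (isog_transl _ isoAH); exact: sub_isog.
move=> H K; rewrite !inE => /andP[sHE _] /andP[sKE _] /(congr1 val) /= eqf.
by apply/val_inj => /=; apply: (injm_morphim_inj f_inj).
Qed.

Lemma nsub_isog (aT cT : finGroupType) (A : {group aT}) (C : {group cT}) :
  A \isog C -> nsub A C = 1%N.
Proof.
move=> isoAC; rewrite /nsub.
rewrite (_ : [set _ | _] = [set C]) ?cards1 //; apply/setP=> H; rewrite !inE.
apply/andP/eqP => [[sHC isoAH]|-> //]; apply/val_inj/eqP => /=.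
by rewrite eqEcard sHC -(card_isog isoAH) -(card_isog isoAC) leqnn.
Qed.

(** * Chains with a prescribed maximum *)

(* Chains are drawn from the representatives of a fixed [C] even when their
   maximum [D] is smaller, so that all the sums below range over the same set. *)
Definition chains_in (aT cT : finGroupType) (A : {set aT}) (C D : {group cT}) :
    {set {set {group cT}}} :=
  [set X : {set {group cT}} | [&& X \subset iso_reps C, is_chain A X, D \in X
     & [forall B : {group cT} in X, injects B D]]].

Definition S_in (aT cT : finGroupType) (A : {set aT}) (C D : {group cT}) : int :=
  if ~~ injects A D then 0%R
  else if A \isog D then 1%R
  else (\sum_(X in chains_in A C D) sub_chain A X)%R.

Lemma Sfun_S_in (aT cT : finGroupType) (A : {set aT}) (C : {group cT}) :
  Sfun A C = S_in A C C.
Proof. by []. Qed.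

Lemma is_chainP (aT cT : finGroupType) (A : {set aT}) (X : {set {group cT}}) :
  reflect ({in X, forall B : {group cT}, lt_iso A B} /\
           {in X &, forall B D : {group cT}, injects B D || injects D B}) (is_chain A X).
Proof.
apply: (iffP andP) => [[/forall_inP ltX /forall_inP totX]|[ltX totX]].
  by split=> // B D XB XD; move/forall_inP: (totX B XB) => /(_ D XD).
split; apply/forall_inP=> B XB; first exact: ltX.
by apply/forall_inP=> D XD; exact: totX.
Qed.

Lemma iso_reps_anti (cT : finGroupType) (C : {group cT}) :
  {in iso_reps C &, forall B D : {group cT}, injects B D -> injects D B -> B = D}.
Proof.
have [_ Rinj _] := iso_repsP C.
by move=> B D RB RD BD DB; apply: Rinj => //; exact: injects_anti_isog.
Qed.

(** The only subgroup of [C] isomorphic to [C] is [C], so no choice is made for this class. *)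
Lemma mem_iso_reps_self (cT : finGroupType) (C : {group cT}) : C \in iso_reps C.
Proof.
have [Rsub _ Rex] := iso_repsP C.
have [K RK isoCK] := Rex C (subxx C).
suff eqCK : C = K by rewrite {1}eqCK.
by apply/esym/val_inj/eqP; rewrite /= eqEcard Rsub //= (card_isog isoCK).
Qed.

(** Both lists are sorted and have the same members. Embeddability is antisymmetric on
    representatives, so a sorted list is determined by its members. *)
Lemma sort_chain_max (cT : finGroupType) (C D : {group cT})
    (X : {set {group cT}}) (e := fun B D : {group cT} => injects B D) :
    X \subset iso_reps C -> {in X &, total e} -> D \in X ->
    {in X, forall B : {group cT}, injects B D} ->
  sort e (enum X) = rcons (sort e (enum (X :\ D))) D.
Proof.
move=> sXR totX XD maxD.
have etr : transitive e by move=> B1 B2 B3; exact: injects_trans.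
have sub1 : all [in X] (enum X) by apply/allP=> B; rewrite mem_enum.
have sub2 : all [in X] (enum (X :\ D)).
  by apply/allP=> B; rewrite mem_enum => /setD1P[].
apply: (@sorted_eq_in _ e).
- by move=> B1 B2 B3 _ _ _; exact: etr.
- move=> B1 B2; rewrite !mem_sort !mem_enum => XB1 XB2 /andP[].
  by apply: iso_reps_anti; exact: (subsetP sXR).
- exact: (sort_sorted_in totX).
- rewrite sorted_pairwise // pairwise_rcons -sorted_pairwise //.
  rewrite (sort_sorted_in totX) // andbT; apply/allP=> B.
  by rewrite mem_sort mem_enum => /setD1P[_ /maxD].
- rewrite perm_sym perm_rcons; apply: uniq_perm.
  + by rewrite /= mem_sort mem_enum !inE eqxx sort_uniq enum_uniq.
  + by rewrite sort_uniq enum_uniq.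
  move=> B; rewrite inE !mem_sort !mem_enum !inE.
  by case: eqP => [->|].
Qed.

Lemma sub_chain1 (aT cT : finGroupType) (A : {set aT}) (D : {group cT}) :
  sub_chain A [set D] = (- (nsub A D)%:R)%R.
Proof.
rewrite /sub_chain enum_set1 cards1 /= big_geq // GRing.mulr1 GRing.expr1.
by rewrite GRing.mulN1r.
Qed.

(** A new maximum [D] above the old maximum [B] flips the sign and appends the single factor
    [nsub B D]. *)
Lemma sub_chainU1 (aT cT : finGroupType) (A : {set aT}) (C B D : {group cT})
    (X : {set {group cT}}) :
    D \in iso_reps C -> X \in chains_in A C B -> D \notin X ->
    injects B D ->
  sub_chain A (D |: X) = (- (nsub B D)%:R * sub_chain A X)%R.
Proof.
move=> RD; rewrite inE => /and4P[sXR /is_chainP[_ totX] XB /forall_inP maxB].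
move=> notXD BD; set e := fun B D : {group cT} => injects B D.
have maxD : {in D |: X, forall K : {group cT}, injects K D}.
  move=> K /setU1P[->|/maxB KB]; first exact/isog_injects/isog_refl.
  exact: injects_trans KB BD.
have totDX : {in D |: X &, total e}.
  move=> K L DXK DXL; rewrite /e.
  case/setU1P: (DXK) => [->|XK]; first by rewrite maxD ?orbT.
  by case/setU1P: (DXL) => [->|XL]; [rewrite maxD | exact: totX].
have sDXR : D |: X \subset iso_reps C by rewrite subUset sub1set RD.
have sE := sort_chain_max sDXR totDX (setU11 _ _) maxD.
have sEX := sort_chain_max sXR totX XB maxB.
rewrite setU1K // in sE.
rewrite /sub_chain -/e sE cardsU1 notXD add1n /=.
have szX : size (sort e (enum X)) = #|X| by rewrite size_sort -cardE.
move: szX; rewrite sEX size_rcons; set t := sort _ _ => szX.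
rewrite -szX /= GRing.exprS.
(* The last index, [size t], reads off the pair [B], [D]. The least member is unchanged because
   [rcons t B] is nonempty. *)
rewrite big_nat_recr //= !nth_rcons !size_rcons ltnS leqnn ltnn eqxx.
rewrite leq0n ltnn eqxx.
(* For [i < size t] both [i] and [i.+1] fall inside [rcons t B], so the appended [D] is not seen. *)
rewrite (_ : (\prod_(0 <= i < size t) _)%R =
   (\prod_(0 <= j < size t)
      (nsub (nth 1%G (rcons t B) j) (nth 1%G (rcons t B) j.+1))%:R)%R); last first.
  apply: eq_big_nat => i /andP[_ lti].
  by rewrite (nth_rcons _ (rcons t B)) (nth_rcons _ (rcons t B) D i.+1)
    size_rcons !ltnS lti (ltnW lti).
rewrite !GRing.mulN1r !GRing.mulNr; congr (- _)%R.
by rewrite [RHS]GRing.mulrC !GRing.mulrA.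
Qed.

Lemma lt_iso_injects_trans (aT bT cT : finGroupType)
    (A : {group aT}) (B : {group bT}) (D : {group cT}) :
  lt_iso A B -> injects B D -> lt_iso A D.
Proof.
case/andP=> AB /negP nisoAB BD; apply/andP; split; first exact: injects_trans AB BD.
apply/negP=> isoAD; case: nisoAB; apply: injects_isog => //.
by rewrite (card_isog isoAD) leq_card_injects.
Qed.

(** Take [B] of largest order in [X :\ D]. Members of a chain are comparable, and a member into
    which [B] embeds has no larger order, hence is isomorphic to [B]; so [B] is the maximum of what
    remains. *)
Lemma chain_max_below (aT cT : finGroupType) (A : {group aT})
    (C D : {group cT}) (X : {set {group cT}}) :
    X \in chains_in A C D -> X != [set D] ->
  exists2 B : {group cT}, [/\ B \in iso_reps C, lt_iso A B, injects B D & B != D]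
    & X :\ D \in chains_in A C B.
Proof.
rewrite inE => /and4P[sXR /is_chainP[ltX totX] XD /forall_inP maxD] nX.
have [/eqP|[K XDK]] := set_0Vmem (X :\ D).
  by rewrite setD_eq0 subset1 (negPf nX) => /eqP X0; rewrite X0 inE in XD.
have [B XDB maxB] := @arg_maxnP _ K [in X :\ D] (fun H => #|H|) XDK.
have /setD1P[nBD XB] := XDB.
exists B.
  by split=> //; [exact: (subsetP sXR) | exact: ltX | exact: maxD].
rewrite inE XDB (subset_trans (subD1set _ _)) //=; apply/andP; split.
  apply/is_chainP; split=> [H /setD1P[_]|H L /setD1P[_ XH] /setD1P[_ XL]].
    exact: ltX.
  exact: totX.
apply/forall_inP=> H XDH; have /setD1P[_ XH] := XDH.
case/orP: (totX H B XH XB) => // BH.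
apply/isog_injects; rewrite isog_sym; apply: injects_isog => //.
exact: maxB.
Qed.

Lemma chains_in_max_uniq (aT cT : finGroupType) (A : {set aT})
    (C B D : {group cT}) (X : {set {group cT}}) :
  X \in chains_in A C B -> X \in chains_in A C D -> B = D.
Proof.
rewrite !inE => /and4P[/subsetP sXR _ XB /forall_inP maxB].
case/and4P=> _ _ XD /forall_inP maxD.
by apply: (@iso_reps_anti _ C); rewrite ?sXR ?maxB ?maxD.
Qed.

Lemma chains_in_notin (aT cT : finGroupType) (A : {set aT})
    (C B D : {group cT}) (X : {set {group cT}}) :
    D \in iso_reps C -> injects B D -> B != D -> X \in chains_in A C B ->
  D \notin X.
Proof.
rewrite inE => RD BD nBD /and4P[/subsetP sXR _ XB /forall_inP maxB].
apply: contra nBD => XD; apply/eqP.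
by apply: (@iso_reps_anti _ C); rewrite ?sXR ?maxB.
Qed.

Lemma chains_inU1 (aT cT : finGroupType) (A : {group aT})
    (C B D : {group cT}) (X : {set {group cT}}) :
    D \in iso_reps C -> lt_iso A B -> injects B D ->
    X \in chains_in A C B ->
  D |: X \in chains_in A C D.
Proof.
move=> RD AB BD; rewrite inE.
case/and4P=> sXR /is_chainP[ltX totX] XB /forall_inP maxB.
have maxD : {in D |: X, forall K : {group cT}, injects K D}.
  move=> K /setU1P[->|/maxB KB]; first exact/isog_injects/isog_refl.
  exact: injects_trans KB BD.
rewrite inE subUset sub1set RD sXR setU11 /=; apply/andP; split.
  apply/is_chainP; split=> [K /setU1P[->|/ltX//]|K L DXK DXL].
    exact: lt_iso_injects_trans AB BD.
  case/setU1P: (DXK) => [->|XK]; first by rewrite maxD ?orbT.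
  by case/setU1P: (DXL) => [->|XL]; [rewrite maxD | exact: totX].
exact/forall_inP.
Qed.

Lemma set1_chains_in (aT cT : finGroupType) (A : {group aT}) (C D : {group cT}) :
  D \in iso_reps C -> lt_iso A D -> [set D] \in chains_in A C D.
Proof.
move=> RD ltAD; rewrite inE sub1set RD set11 /=; apply/andP; split.
  apply/is_chainP; split=> [B /set1P-> //|B K /set1P-> /set1P->].
  by rewrite isog_injects ?isog_refl.
by apply/forall_inP=> B /set1P->; exact/isog_injects/isog_refl.
Qed.

(** * The recursion for S and its inversion *)

(** The chain [[set D]] gives the first term. The other chains are sorted by their second largest
    member [B], and deleting [D] maps those with a given [B] bijectively onto the chains with
    maximum [B]. *)
Lemma sum_sub_chain_rec (aT cT : finGroupType) (A : {group aT})
    (C D : {group cT}) :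
    D \in iso_reps C -> lt_iso A D ->
  (\sum_(X in chains_in A C D) sub_chain A X =
   - (nsub A D)%:R -
   \sum_(B in iso_reps C | [&& lt_iso A B, injects B D & B != D])
      (nsub B D)%:R * \sum_(X in chains_in A C B) sub_chain A X)%R.
Proof.
move=> RD ltAD; rewrite (bigD1 [set D]) ?set1_chains_in //= sub_chain1.
congr (_ + _)%R; rewrite -GRing.sumrN.
pose below X (B : {group cT}) :=
  [&& B \in iso_reps C, lt_iso A B, injects B D, B != D & X :\ D \in chains_in A C B].
pose top X := odflt D [pick B | below X B].
have topP X B : below X B -> top X = B.
  move=> XB; rewrite /top; case: pickP => [K|/(_ B)]; last by rewrite XB.
  case/and5P=> _ _ _ _ chK; case/and5P: XB => _ _ _ _ chB.
  exact: chains_in_max_uniq chK chB.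
rewrite (partition_big top
  [pred B in iso_reps C | [&& lt_iso A B, injects B D & B != D]]) /=; last first.
  move=> X /andP[chX nX]; have [B [RB AB BD nBD] chB] := chain_max_below chX nX.
  by rewrite (topP X B) ?RB ?AB ?BD // /below RB AB BD nBD chB.
apply: eq_bigr => B /and4P[RB AB BD nBD].
rewrite -GRing.mulNr GRing.mulr_sumr.
have notin X : X \in chains_in A C B -> D \notin X.
  exact: chains_in_notin.
rewrite (reindex_onto (fun X => D |: X) (fun X => X :\ D)) /=; last first.
  move=> X /andP[/andP[]]; rewrite inE => /and4P[_ _ XD _] _ _.
  exact: setD1K.
apply: eq_big => [X|X /andP[/andP[/andP[chX nX] /eqP tX] /eqP eX]]; last first.
  have [K [RK AK KD nKD]] := chain_max_below chX nX; rewrite eX => chK.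
  have eKB: K = B.
    by rewrite -tX; apply/esym/topP; rewrite /below RK AK KD nKD eX.
  by rewrite eKB in chK; apply: (@sub_chainU1 _ _ _ C) => //; exact: notin.
apply/idP/idP => [/andP[/andP[/andP[chX nX] /eqP tX] /eqP eX]|chX].
  have [K [RK AK KD nKD]] := chain_max_below chX nX; rewrite eX => chK.
  suff <- : K = B by [].
  by rewrite -tX; apply/esym/topP; rewrite /below RK AK KD nKD eX.
have nDX := notin X chX.
rewrite (chains_inU1 (B := B)) // setU1K // eqxx andbT /=; apply/andP; split.
  have XB : B \in X by case/setIdP: chX => _ /and3P[].
  apply: contra nBD => /eqP/setP/(_ B).
  by rewrite !inE XB orbT => /esym.
by apply/eqP/topP; rewrite /below RB AB BD nBD setU1K.
Qed.

Lemma sum_nsub_S_in (aT cT : finGroupType) (A : {group aT}) (C D : {group cT}) :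
    D \in iso_reps C ->
  (\sum_(B in iso_reps C) (nsub B D)%:R * S_in A C B = (A \isog D)%:R)%R.
Proof.
move=> RD; have [Rsub Rinj Rex] := iso_repsP C.
have nsub0 (B : {group cT}) : ~~ injects B D -> nsub B D = 0%N.
  by rewrite -nsub_gt0 lt0n negbK => /eqP.
have S0 (B : {group cT}) : ~~ injects A B -> S_in A C B = 0%R.
  by rewrite /S_in => ->.
rewrite (bigD1 D) //= nsub_isog ?isog_refl // GRing.mul1r.
(* If [A] is isomorphic to [D], a nonzero term needs [A <= B <= D], which leaves only [B = D]. *)
have [isoAD|nisoAD] := boolP (A \isog D).
  rewrite {1}/S_in isog_injects //= isoAD big1 ?GRing.addr0 // => B /andP[RB nBD].
  have [BD|/nsub0->] := boolP (injects B D); last by rewrite GRing.mul0r.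
  rewrite S0 ?GRing.mulr0 //; apply: contra nBD => AB; apply/eqP.
  apply: iso_reps_anti RB RD BD _.
  by apply: injects_trans AB; rewrite isog_injects // isog_sym.
have [AD|nAD] := boolP (injects A D); last first.
  rewrite S0 // big1 ?GRing.addr0 // => B /andP[RB _].
  have [BD|/nsub0->] := boolP (injects B D); last by rewrite GRing.mul0r.
  rewrite S0 ?GRing.mulr0 //; apply: contra nAD => AB.
  exact: injects_trans AB BD.
have ltAD : lt_iso A D by rewrite /lt_iso AD.
rewrite {1}/S_in AD (negPf nisoAD) /= sum_sub_chain_rec //.
have [K sKD isoAK] := injects_isogP _ _ AD.
(* [B0] represents the class of [A]. Its term is [nsub A D], which cancels the contribution of the
   chain [[set D]] to the recursion. *)
have [B0 RB0 isoKB0] := Rex K (subset_trans sKD (Rsub D RD)).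
have isoAB0 : A \isog B0 by rewrite (isog_transl _ isoAK).
have nB0D : B0 != D by apply: contra nisoAD => /eqP <-.
rewrite [X in (_ + X)%R](bigD1 B0) ?RB0 //= {1}/S_in isog_injects //= isoAB0 GRing.mulr1.
rewrite (nsub_isogl _ isoAB0) GRing.addrACA GRing.addNr GRing.add0r.
rewrite GRing.addrC; apply/eqP; rewrite GRing.subr_eq0; apply/eqP.
(* The remaining sums agree term by term: a representative counted on one side only fails to lie
   above [A] or below [D], so its term is zero. *)
rewrite [RHS]big_mkcondr [LHS]big_mkcondr /= [LHS]big_mkcondr /=.
apply: eq_bigr => B RB.
have [->|nBB0] := eqVneq B B0; first by rewrite /lt_iso isoAB0 andbF nB0D.
have [_|nBD] := eqVneq B D; first by rewrite !andbF.
rewrite /= andbT.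
have [BD|/nsub0->] := boolP (injects B D); last by rewrite andbF GRing.mul0r.
rewrite andbT /lt_iso /S_in; case: (injects A B); last by rewrite GRing.mulr0.
case: ifP => //= isoAB; case/eqP: nBB0; apply: Rinj => //.
by rewrite -(isog_transl _ isoAB).
Qed.

(* [S_in _ _ B] is counted once for each of the [nsub B M] subgroups of [M]
   isomorphic to [B]. *)
Lemma Sfun_sum_subgroups (aT cT : finGroupType) (A : {group aT}) (C : {group cT}) :
  exists2 f : {group cT} -> int, f C = Sfun A C
    & forall M : {group cT}, M \subset C ->
        (\sum_(H : {group cT} | H \subset M) f H = (A \isog M)%:R)%R.
Proof.
have [Rsub Rinj Rex] := iso_repsP C.
(* The default [1%G] is reached only outside the subgroups of [C]. *)
pose rep (H : {group cT}) := odflt 1%G [pick K in iso_reps C | H \isog K].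
have repP (H : {group cT}) : H \subset C -> rep H \in iso_reps C /\ H \isog rep H.
  move=> sHC; rewrite /rep; case: pickP => [K /andP[] //|noK].
  by have [K RK isoHK] := Rex H sHC; move: (noK K); rewrite RK isoHK.
have rep_eq (H K : {group cT}) : H \subset C -> K \in iso_reps C ->
    (rep H == K) = (K \isog H).
  move=> /repP[RH isoH] RK; apply/eqP/idP => [<-|isoKH]; first by rewrite isog_sym.
  by apply: Rinj; rewrite // isog_sym (isog_transl _ isoKH).
exists (fun H => S_in A C (rep H)) => [|M sMC].
  rewrite Sfun_S_in; congr S_in; apply/eqP.
  by rewrite rep_eq ?isog_refl ?mem_iso_reps_self.
have [RM isoM] := repP M sMC.
have -> : A \isog M = (A \isog rep M).
  by rewrite isog_sym (isog_transl _ isoM) isog_sym.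
rewrite -(sum_nsub_S_in A RM).
rewrite (partition_big rep [in iso_reps C]) /= => [|H sHM]; last first.
  by have [] := repP H (subset_trans sHM sMC).
apply: eq_bigr => B RB; rewrite -(nsub_isogr B isoM) GRing.mulr_natl.
rewrite -GRing.sumr_const; apply: eq_big => [H|H /andP[_ /eqP->] //].
rewrite inE; have [sHM /=|//] := boolP (H \subset M).
by rewrite rep_eq // (subset_trans sHM).
Qed.

(** * Grouping subgroups by their join with the Frattini subgroup *)

(* A form of Weisner's theorem: the sums T(M) of [f] over the [H] with [H N = M]
   satisfy [\sum_(N <= K <= M) T(K) = 0], hence vanish by induction on [M]. *)
Lemma sum_joing_eq0 (cT : finGroupType) (C N : {group cT})
    (f : {group cT} -> int) :
    N \subset C ->
    (forall M : {group cT}, N \subset M -> M \subset C ->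
       \sum_(H : {group cT} | H \subset M) f H = 0)%R ->
  (\sum_(H : {group cT} | (H <*> N)%G == C) f H = 0)%R.
Proof.
move=> sNC f0.
suff T0 n (M : {group cT}) : #|M| < n -> N \subset M -> M \subset C ->
    (\sum_(H : {group cT} | (H <*> N)%G == M) f H = 0)%R.
  exact: (T0 #|C|.+1).
elim: n M => // n IHn M; rewrite ltnS => leMn sNM sMC.
have := f0 M sNM sMC.
rewrite (partition_big (fun H : {group cT} => (H <*> N)%G)
  [pred K : {group cT} | (N \subset K) && (K \subset M)]) /=; last first.
  by move=> H sHM; rewrite joing_subr join_subG sHM.
(* [H] lies in its join [K] with [N], so the bound by [M] is automatic and the inner sums are those
   of the induction. *)
have sumE (K : {group cT}) : K \subset M ->
  (\sum_(H : {group cT} | (H \subset M) && ((H <*> N)%G == K)) f H =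
   \sum_(H : {group cT} | (H <*> N)%G == K) f H)%R.
  move=> sKM; apply: eq_bigl => H; apply: andb_idl => /eqP eqK.
  by apply: subset_trans sKM; rewrite -eqK joing_subl.
rewrite (bigD1 M) ?sNM ?subxx //= sumE // [X in (_ + X)%R]big1 ?GRing.addr0 // => K.
case/andP=> /andP[sNK sKM] nKM; rewrite sumE // IHn //; last first.
  exact: subset_trans sKM sMC.
by apply: leq_trans leMn; rewrite proper_card // properEneq sKM andbT.
Qed.

(** In a p-group, ['Phi(C)] is generated by the commutators and the p-th powers, so every p-th power
    dies in [C / M]. *)
Lemma Phi_sub_quotient_abelem (p : nat) (gT : finGroupType) (M C : {group gT}) :
    prime p -> p.-group C -> abelian C -> 'Phi(C) \subset M -> M \subset C ->
  p.-abelem (C / M).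
Proof.
move=> p_pr pC abC sPhiM sMC; apply/abelemP=> //.
split=> [|_ /morphimP[x Nx Cx ->]]; first exact: quotient_abelian.
rewrite -morphX //; apply: coset_id; apply: (subsetP sPhiM).
rewrite (Phi_joing pC); apply: (subsetP (joing_subr _ _)).
by rewrite -[p in x ^+ p]expn1 Mho_p_elt // (mem_p_elt pC).
Qed.

Unset Implicit Arguments.
Set Strict Implicit.

Theorem theorem3p9 (ell : nat) (ell_prime : prime ell) (ell_odd : odd ell)
    (aT cT : finGroupType) (A : {group aT}) (C : {group cT})
    (A_abelian : abelian A) (A_ellgroup : ell.-group A)
    (C_abelian : abelian C) (C_ellgroup : ell.-group C)
    (r : nat) (rank_A : rank_mod ell A = r) (rank_C : rank_mod ell C = r)
    (no_elementary_coker :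
       ~ (exists iota : {morphism A >-> cT},
            [/\ 'injm iota, iota @* A \subset C
              & ell.-abelem (C / (iota @* A))])) :
  Sfun A C = 0%R.
Proof.
have [f <- sum_f] := Sfun_sum_subgroups A C.
have sPhiC : 'Phi(C) \subset C := Phi_sub C.
have := @sum_joing_eq0 _ C 'Phi(C)%G f sPhiC.
(* A subgroup that generates [C] together with ['Phi(C)] is already [C], so the sum reduces to
   [f C]. *)
rewrite (big_pred1 C) => [|H]; last first.
  apply/eqP/eqP => [/(congr1 val) /=|->]; last first.
    by apply/val_inj => /=; apply/joing_idPl.
  by rewrite joingC => /Phi_nongen; rewrite genGid => eqHC; apply/val_inj.
(* An isomorphism from [A] onto such an [M] would be an embedding with cokernel [C / M], which is
   elementary abelian. *)
apply=> M sPhiM sMC; rewrite sum_f //; case: isogP => // -[iota iota_inj im].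
case: no_elementary_coker; exists iota; rewrite im; split=> //.
exact: Phi_sub_quotient_abelem.
Qed.
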